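(* Let $W$ be a finite Coxeter group with root system $R\subset\mathbb{R}^n$, positive roots $R^+$ and simple roots $\alpha_1,\dots,\alpha_n$. Let $\gamma\in\mathbb{R}^n$ be dominant and let $\Gamma(\gamma)$ be the calibration graph of $\gamma$. Then the connected components of $\Gamma(\gamma)$ are described by the sets $\mathcal{F}^{(\gamma,J)}$ with $J\subseteq P(\gamma)$ and $\mathcal{F}^{(\gamma,J)}\neq\emptyset$. That is: for each $J\subseteq P(\gamma)$ with $\mathcal{F}^{(\gamma,J)}\ne\emptyset$ the map $w\mapsto w\gamma$ is injective on $\mathcal{F}^{(\gamma,J)}$ and its image is the vertex set of a connected component of $\Gamma(\gamma)$; and $J\mapsto \{w\gamma \mid w\in\mathcal{F}^{(\gamma,J)}\}$ is a bijection from $\{J\subseteq P(\gamma)\mid \mathcal{F}^{(\gamma,J)}\neq\emptyset\}$ onto the set of (vertex sets of) connected components of $\Gamma(\gamma)$.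
   Context: $W$ is a finite Coxeter group acting on $\mathbb{R}^n$ as a group generated by reflections with respect to an inner product $\langle\cdot,\cdot\rangle$; $R$ is its (reduced) root system, spanning $\mathbb{R}^n$. Fix a system $R^+$ of positive roots (write $\alpha>0$ for $\alpha\in R^+$ and $\alpha<0$ for $\alpha\in -R^+$), with simple roots $\alpha_1,\dots,\alpha_n$ and simple reflections $s_1,\dots,s_n$. The fundamental chamber is $C=\{x\in\mathbb{R}^n\mid \langle x,\alpha\rangle>0\text{ for all }\alpha\in R^+\}$; $x$ is dominant if $x\in\overline{C}$. The inversion set of $w\in W$ is $R(w)=\{\alpha>0\mid w\alpha<0\}$. For dominant $\gamma$ put $Z(\gamma)=\{\alpha\in R^+\mid\langle\gamma,\alpha\rangle=0\}$ and $P(\gamma)=\{\alpha\in R\mid\langle\gamma,\alpha\rangle=1\}$. For $J\subseteq P(\gamma)$, $$\mathcal{F}^{(\gamma,J)}=\{w\in W\mid R(w)\cap Z(\gamma)=\emptyset,\ R(w)\cap P(\gamma)=J\}.$$ The calibration graph $\Gamma(\gamma)$ has vertex set the orbit $W\gamma$ and edges $w\gamma\leftrightarrow s_iw\gamma$ ($w\in W$, $1\le i\le n$) whenever $\langle w\gamma,\alpha_i\rangle\neq\pm1$. *)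

(* Defs.v *)
From HB Require Import structures.
From mathcomp Require Import all_boot all_order all_algebra.
From mathcomp Require Import all_classical all_reals all_analysis.
From Stdlib Require Import Relation_Operators.

Set Implicit Arguments.
Unset Strict Implicit.
Unset Printing Implicit Defensive.

Import Order.TTheory GRing.Theory Num.Theory numFieldNormedType.Exports.
Local Open Scope classical_set_scope.
Local Open Scope ring_scope.

Section ReflectionGroups.
Variables (R : realType) (n : nat).
Local Notation V := 'cV[R]_n.
Variable dot : {dot V for idfun}.

Definition reflection (a x : V) : V := x - (2 * dot x a / dot a a) *: a.

Fact reflection_is_linear (a : V) : linear (reflection a).
Proof.
move=> c x y; rewrite /reflection linearPl /=.
have -> : 2 * (c * dot x a + dot y a) / dot a a =
    c * (2 * dot x a / dot a a) + 2 * dot y a / dot a a.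
  by rewrite mulrDr mulrDl mulrCA !mulrA.
by rewrite scalerDl opprD addrACA scalerBr scalerA.
Qed.

HB.instance Definition _ (a : V) :=
  GRing.isLinear.Build R V V *:%R (reflection a) (reflection_is_linear a).

Definition refl (a : V) : 'End(V) := linfun (reflection a).

(* Not necessarily crystallographic; stability under opposite follows from
   [refl a a = - a]. *)
Record is_root_system (Phi : set V) : Prop := IsRootSystem {
  root_finite : finite_set Phi;
  root_neq0 : forall a, Phi a -> a != 0;
  root_reduced : forall a c, Phi a -> Phi (c *: a) -> c = 1 \/ c = -1;
  root_stable : forall a b, Phi a -> Phi b -> Phi (refl a b);
  root_span : exists s : seq V, [set` s] `<=` Phi /\ span s = fullv
}.

(* Words in the reflections: since each [refl a] is an involution, these are
   closed under inverses and form the group generated by the reflections. *)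
Inductive reflection_group (Phi : set V) : set 'End(V) :=
| reflection_group1 : reflection_group Phi \1%VF
| reflection_groupM a w : Phi a -> reflection_group Phi w ->
    reflection_group Phi (refl a \o w)%VF.

Definition is_positive_system (Phi Pos : set V) : Prop :=
  exists v : V, (forall a, Phi a -> dot v a != 0) /\
                Pos = [set a | Phi a /\ 0 < dot v a].

Definition is_simple_system (Phi Pos : set V) (alpha : n.-tuple V) : Prop :=
  [/\ basis_of fullv alpha,
      forall i, Pos (tnth alpha i) &
      forall b, Phi b ->
        (forall i, 0 <= coord alpha i b) \/ (forall i, coord alpha i b <= 0)].

Definition chamber (Pos : set V) : set V :=
  [set x | forall a, Pos a -> 0 < dot x a].

Definition dominant (Pos : set V) : set V := closure (chamber Pos).

Definition inversions (Pos : set V) (w : 'End(V)) : set V :=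
  [set a | Pos a /\ Pos (- w a)].

Definition Zset (Pos : set V) (gamma : V) : set V :=
  [set a | Pos a /\ dot gamma a = 0].

Definition Pset (Phi : set V) (gamma : V) : set V :=
  [set a | Phi a /\ dot gamma a = 1].

Definition Fset (Phi Pos : set V) (gamma : V) (J : set V) : set 'End(V) :=
  [set w | [/\ reflection_group Phi w,
               inversions Pos w `&` Zset Pos gamma = set0 &
               inversions Pos w `&` Pset Phi gamma = J]].

Definition translates (F : set 'End(V)) (gamma : V) : set V :=
  [set (w : 'End(V)) gamma | w in F].

Definition calibration_vertices (Phi : set V) (gamma : V) : set V :=
  translates (reflection_group Phi) gamma.

(* The edges are unordered; loops (when [w gamma] is orthogonal to the simple
   root) are kept, which does not affect connectedness. *)
Definition calibration_edge (Phi : set V) (alpha : n.-tuple V) (gamma : V)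
    (x y : V) : Prop :=
  exists (w : 'End(V)) (i : 'I_n),
    [/\ reflection_group Phi w,
        dot (w gamma) (tnth alpha i) != 1,
        dot (w gamma) (tnth alpha i) != -1 &
        (x = w gamma /\ y = refl (tnth alpha i) (w gamma)) \/
        (y = w gamma /\ x = refl (tnth alpha i) (w gamma))].

Definition calibration_connected (Phi : set V) (alpha : n.-tuple V)
    (gamma : V) : V -> V -> Prop :=
  clos_refl_trans V (calibration_edge Phi alpha gamma).

(* [A] is the vertex set of a connected component of the calibration graph. *)
Definition is_calibration_component (Phi : set V) (alpha : n.-tuple V)
    (gamma : V) (A : set V) : Prop :=
  exists2 x, calibration_vertices Phi gamma x &
    A = [set y | calibration_vertices Phi gamma y /\
                 calibration_connected Phi alpha gamma x y].

End ReflectionGroups.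

(* Main.v *)
(* By the exchange condition, an element of W preserving the positive roots is
   trivial.  If R(w) is disjoint from Z(gamma), the sign of w^-1 b for a root b
   is determined by the point w gamma (and the sign of b), so each vertex is
   w gamma for exactly one such w; a representative of minimal length exists.
   Crossing an edge from w gamma to s_i w gamma with nonzero pairing changes
   only the sign of the root a = w^-1 alpha_i, and <gamma, a> is not 0, 1 or -1,
   so J = R(w) meet P(gamma) is constant on components.  Conversely, let w, w'
   lie in F^(gamma,J) and let u = w' w^-1.  If u <> 1, some simple alpha_i has
   u alpha_i < 0; the root w^-1 alpha_i then separates w from w', hence pairs
   with gamma to none of 0, 1, -1, and stepping from w to s_i w along an edge
   shortens u. *)

Require Import Defs.
From mathcomp Require Import all_boot all_order all_algebra.
From mathcomp Require Import all_classical all_reals all_analysis.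
From mathcomp Require Import ring.
From Stdlib Require Import Relation_Operators.

Set Implicit Arguments.
Unset Strict Implicit.
Unset Printing Implicit Defensive.

Import Order.TTheory GRing.Theory Num.Theory numFieldNormedType.Exports.
Local Open Scope classical_set_scope.
Local Open Scope ring_scope.

Lemma sub_count_lt (T : eqType) (p q : pred T) (r : seq T) x :
  subpred p q -> x \in r -> q x -> ~~ p x -> (count p r < count q r)%N.
Proof.
move=> pq xr qx npx; rewrite -(size_filter q) -(count_predC p) !count_filter.
rewrite (@eq_count _ (predI p q) p) => [|y /=].
  by rewrite -[ltnLHS]addn0 ltn_add2l -has_count; apply/hasP; exists x => //=;
  rewrite npx.
by case py : (p y); rewrite //= pq.
Qed.

(** * Reflections of a real inner product space *)

Section Reflections.
Variables (R : realType) (n : nat) (dot : {dot 'cV[R]_n for idfun}).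
Local Notation V := 'cV[R]_n.
Implicit Types (a b x y : V) (w : 'End(V)).

Lemma dotC x y : dot x y = dot y x.
Proof. by rewrite hermC /= expr0 mul1r. Qed.

Lemma dot_gt0 x : x != 0 -> 0 < dot x x.
Proof. exact: neq0_dnorm_gt0. Qed.

Lemma dotZl c x y : dot (c *: x) y = c * dot x y.
Proof. exact: linearZl_LR. Qed.

Lemma dotZr c x y : dot x (c *: y) = c * dot x y.
Proof. by rewrite dotC dotZl dotC. Qed.

Lemma dotNr x y : dot x (- y) = - dot x y.
Proof. by rewrite -scaleN1r dotZr mulN1r. Qed.

Lemma reflE a x : refl dot a x = x - (2 * dot x a / dot a a) *: a.
Proof. by rewrite lfunE. Qed.

Lemma reflN a : refl dot (- a) = refl dot a.
Proof.
apply/lfunP => x; rewrite !reflE !dotNr (dotC (- a)) dotNr opprK.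
by rewrite mulrN mulNr scaleNr scalerN opprK.
Qed.

Lemma refl_self a : a != 0 -> refl dot a a = - a.
Proof.
move=> /dot_gt0 /lt0r_neq0 a0; rewrite reflE mulfK //.
by rewrite scaler_nat mulr2n opprD addNKr.
Qed.

Lemma refl_ortho a x : dot x a = 0 -> refl dot a x = x.
Proof. by move=> xa; rewrite reflE xa mulr0 mul0r scale0r subr0. Qed.

Lemma dot_refl a x y : a != 0 -> dot (refl dot a x) (refl dot a y) = dot x y.
Proof.
move=> /dot_gt0 /lt0r_neq0 a0; rewrite !reflE !(linearBl, linearBr) /=.
rewrite !(dotZl, dotZr) (dotC a y).
field; exact: a0.
Qed.

Lemma reflK a : a != 0 -> involutive (refl dot a).
Proof.
move=> a0 x; rewrite [refl dot a x]reflE linearB linearZ /= refl_self //.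
by rewrite reflE scalerN opprK subrK.
Qed.

Lemma dot_refl_sym a x y : a != 0 ->
  dot (refl dot a x) y = dot x (refl dot a y).
Proof. by move=> a0; rewrite -{1}(reflK a0 y) dot_refl. Qed.

Lemma refl_isometry w a x : (forall x y, dot (w x) (w y) = dot x y) ->
  refl dot (w a) (w x) = w (refl dot a x).
Proof. by move=> iw; rewrite !reflE !iw [in RHS]linearB [in RHS]linearZ. Qed.

Lemma dot_continuous a : continuous (fun x : V => dot x a).
Proof.
have -> : (fun x : V => dot x a) =
    (fun x : V => \sum_(i < n) x i ord0 * dot (delta_mx i ord0) a).
  apply: funext => x; rewrite [in LHS](matrix_sum_delta x).
  rewrite (linear_sumlz dot); apply: eq_bigr => i _.
  by rewrite big_ord1 [LHS]dotZl.
apply: continuous_big => [z|i _ x].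
  exact: (@pseudometric_normed_Zmodule.add_continuous R R^o z).
apply: (@continuousM R V (fun y : V => y i ord0) (fun=> _));
  last exact: cst_continuous.
exact: coord_continuous.
Qed.

End Reflections.

(** * Positive roots and simple reflections *)

Section CoxeterGroup.
Variables (R : realType) (n : nat) (dot : {dot 'cV[R]_n for idfun}).
Variables (Phi Pos : set 'cV[R]_n) (alpha : n.-tuple 'cV[R]_n).
Hypothesis hPhi : is_root_system dot Phi.
Hypothesis hPos : is_positive_system dot Phi Pos.
Hypothesis halpha : is_simple_system Phi Pos alpha.
Local Notation V := 'cV[R]_n.
Local Notation al := (tnth alpha).
Local Notation s i := (refl dot (tnth alpha i)).

Lemma Pos_root a : Pos a -> Phi a.
Proof. by case: hPos => v [_ ->] []. Qed.

Lemma opp_root a : Phi a -> Phi (- a).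
Proof.
move=> ha; rewrite -(refl_self dot); first exact: (root_stable hPhi).
exact: (root_neq0 hPhi ha).
Qed.

Lemma Pos_total a : Phi a -> Pos a \/ Pos (- a).
Proof.
case: hPos => v [v0 ->] ha; have := v0 _ ha.
rewrite neq_lt => /orP[lt|gt]; [right|by left].
by split; [exact: opp_root|rewrite linearN oppr_gt0].
Qed.

Lemma Pos_asym a : Pos a -> ~ Pos (- a).
Proof.
by case: hPos => v [v0 ->] [_ h] [_]; rewrite linearN oppr_gt0 ltNge (ltW h).
Qed.

Lemma simple_Pos i : Pos (al i).
Proof. by case: halpha. Qed.

Lemma simple_neq0 i : al i != 0.
Proof. exact: (root_neq0 hPhi (Pos_root (simple_Pos i))). Qed.
Hint Resolve simple_neq0 simple_Pos : core.

Lemma simple_root i : Phi (al i).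
Proof. exact: Pos_root. Qed.
Hint Resolve simple_root : core.

Lemma coord_simple_sum a : a = \sum_i coord alpha i a *: al i.
Proof.
case: halpha => + _ _; move=> /coord_basis/(_ (memvf a)) {1}->.
by apply: eq_bigr => i _; rewrite (tnth_nth 0).
Qed.

Lemma coord_simple i j : coord alpha j (al i) = (i == j)%:R.
Proof.
case: halpha => /basis_free fa _ _.
by rewrite (tnth_nth 0) coord_free // eq_sym.
Qed.

(** The vector [v] that defines [Pos] pairs positively with every simple root and is orthogonal to
    no root. *)
Lemma nonneg_coord_Pos a : Phi a -> (forall i, 0 <= coord alpha i a) -> Pos a.
Proof.
move=> ha ca; have := simple_Pos; case: hPos => v [v0 ->] hs; split => //.
rewrite lt0r v0 //= [a]coord_simple_sum linear_sumr sumr_ge0 // => i _.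
by rewrite /= dotZr mulr_ge0 // ltW //; case: (hs i).
Qed.

Lemma Pos_coord_ge0 a i : Pos a -> 0 <= coord alpha i a.
Proof.
move=> ha; case: halpha => _ _ /(_ _ (Pos_root ha)) [//|ca].
case: (Pos_asym ha); apply: nonneg_coord_Pos => [|j].
  exact: (opp_root (Pos_root ha)).
by rewrite linearN oppr_ge0; exact: ca.
Qed.

(** By reducedness, a positive root other than [al i] has a positive coordinate at some [j != i].
    The reflection [s i] changes only coordinate [i], and the coordinates of a root share a sign. *)
Lemma simple_refl_Pos i a : Pos a -> a != al i -> Pos (s i a).
Proof.
move=> ha nai.
have [j nij cj] : exists2 j, j != i & 0 < coord alpha j a.
  apply: contrapT => h; move/negP: nai; apply; apply/eqP.
  have ea : a = coord alpha i a *: al i.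
    rewrite [LHS]coord_simple_sum (bigD1 i) //= big1 ?addr0 // => j nij.
    have := Pos_coord_ge0 j ha; rewrite le_eqVlt => /orP[/eqP <-|cj].
      by rewrite scale0r.
    by case: h; exists j.
  have := Pos_coord_ge0 i ha.
  have [||e|->] := root_reduced hPhi (a := al i) (c := coord alpha i a) => //.
  - by rewrite -ea; exact: Pos_root.
  - by move=> _; rewrite [LHS]ea e scale1r.
  - by rewrite lerNr oppr0 ler10.
have hs : Phi (s i a).
  exact: (root_stable hPhi (simple_root i) (Pos_root ha)).
case: halpha => _ _ /(_ _ hs)[|/(_ j)]; first exact: nonneg_coord_Pos.
rewrite reflE linearB linearZ /= coord_simple eq_sym (negPf nij) mulr0 subr0.
by rewrite leNgt cj.
Qed.

(** * Words in the simple reflections and the exchange condition *)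

Fixpoint word (l : seq 'I_n) : 'End(V) :=
  if l is i :: l' then (s i \o word l')%VF else \1%VF.

Lemma word_nil x : word [::] x = x.
Proof. by rewrite lfunE. Qed.

Lemma word_cons i l x : word (i :: l) x = s i (word l x).
Proof. by rewrite comp_lfunE. Qed.

Lemma word_cat l l' x : word (l ++ l') x = word l (word l' x).
Proof.
by elim: l => [|i l IH]; rewrite ?word_nil // cat_cons !word_cons IH.
Qed.

Lemma word_revK l : cancel (word l) (word (rev l)).
Proof.
elim: l => [|i l IH] x; rewrite ?word_nil // rev_cons -cats1 word_cat.
by rewrite !word_cons word_nil reflK // IH.
Qed.

Lemma word_Krev l : cancel (word (rev l)) (word l).
Proof. by rewrite -{2}[l]revK; exact: word_revK. Qed.

Lemma dot_word l x y : dot (word l x) (word l y) = dot x y.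
Proof.
elim: l => [|i l IH]; first by rewrite !word_nil.
by rewrite !word_cons dot_refl // IH.
Qed.

Lemma dot_word_rev l x y : dot (word (rev l) x) y = dot x (word l y).
Proof. by rewrite -(dot_word l) word_Krev. Qed.

Lemma word_root l a : Phi a -> Phi (word l a).
Proof.
move=> ha; elim: l => [|i l IH]; rewrite ?word_nil // word_cons.
exact: (root_stable hPhi (simple_root i) IH).
Qed.

(** As the letters of [l] act in turn on [al i], some letter [j] makes a positive root negative.
    That root must be [al j], so deleting this letter amounts to multiplying by [s i] on the
    right. *)
Lemma word_exchange l i : Pos (- word l (al i)) ->
  exists2 l', size l = (size l').+1 & word l' =1 word (rcons l i).
Proof.
elim: l => [|j l IH].
  by rewrite word_nil => /(Pos_asym (simple_Pos i)).
rewrite word_cons => hn.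
have [hp|hp] := Pos_total (word_root l (simple_root i)).
  have e : word l (al i) = al j.
    apply/eqP; apply: contrapT => /negP ne.
    exact: (Pos_asym (simple_refl_Pos hp ne)).
  exists l => // x.
  rewrite rcons_cons word_cons -cats1 word_cat word_cons word_nil.
  rewrite -refl_isometry; last exact: dot_word.
  by rewrite e reflK.
have [l' sl el] := IH hp.
by exists (j :: l') => [|x]; [rewrite /= sl|rewrite rcons_cons !word_cons el].
Qed.

(** If the word ends in [i], the letters before it send [al i] to a negative root, and exchange
    yields a word two letters shorter for the same map. *)
Lemma word_Pos_id l : (forall i, Pos (word l (al i))) -> word l =1 id.
Proof.
have [k] := ubnP (size l); elim: k l => // k IH l; rewrite ltnS.
elim/last_ind: l => [|l i _] sl hl x; first by rewrite word_nil.
have [|l' sl' el] := @word_exchange l i.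
  have := hl i; rewrite -cats1 word_cat word_cons word_nil refl_self //.
  by rewrite linearN.
rewrite -el IH // => [|j]; last by rewrite el.
by rewrite size_rcons sl' in sl; exact: ltnW.
Qed.

(** Reflecting in a simple root that pairs positively with [a] lowers [a]; this descent can stop
    only at a simple root. *)
Lemma Pos_word_simple a : Pos a -> exists l i, a = word l (al i).
Proof.
have := simple_Pos; have := simple_refl_Pos; have := Pos_coord_ge0.
case: (hPos) => v [v0 ePos] hcoord hs hsimple.
have /finite_seqP[r er] := root_finite hPhi.
(* The height [dot v] need not be an integer; counting the finitely many lower roots gives a natural
   number for the induction. *)
pose N b := count (fun c => dot v c < dot v b) r.
have [k] := ubnP (N a); elim: k a => // k IH a; rewrite ltnS => Na ha.
have [[i ->]|ne] := pselect (exists i, a = al i).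
  by exists [::], i; rewrite word_nil.
(* Otherwise [dot a a], a sum of nonnegative coordinates times [dot a (al i)], would not be
   positive. *)
have [i hi] : exists i, 0 < dot a (al i).
  apply: contrapT => h; have := dot_gt0 dot (root_neq0 hPhi (Pos_root ha)).
  rewrite {2}[a]coord_simple_sum linear_sumr ltNge => /negP; apply.
  apply: sumr_le0 => i _; rewrite /= dotZr mulr_ge0_le0 ?hcoord // leNgt.
  by apply/negP => ?; apply: h; exists i.
have nai : a != al i by apply/eqP => e; apply: ne; exists i.
have hsa := hs i a ha nai.
have lt : dot v (s i a) < dot v a.
  rewrite reflE linearB /= dotZr ltrBlDr ltrDl.
  have := hsimple i; rewrite ePos => -[_ ?].
  by rewrite mulr_gt0 ?divr_gt0 ?mulr_gt0 ?dot_gt0.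
have [|l [j e]] := IH (s i a) _ hsa.
  apply: (leq_trans _ Na); rewrite /N.
  apply: (@sub_count_lt _ _ _ _ (s i a)) => //.
  - by move=> b /= /lt_trans; apply.
  - by have := Pos_root hsa; rewrite er.
  - by rewrite ltxx.
by exists (i :: l), j; rewrite word_cons -e reflK.
Qed.

(** Up to sign every root is [word l0 (al i)], and its reflection is the conjugate of [s i] by
    [word l0]. *)
Lemma group_word w : reflection_group dot Phi w <-> exists l, w = word l.
Proof.
split=> [|[l ->{w}]]; last first.
  by elim: l => [|i l IH] /=; constructor.
elim=> [|a u ha _ [l ->]]; first by exists [::].
have [l0 [i e]] : exists l i, refl dot a = refl dot (word l (al i)).
  have [/Pos_word_simple[l' [i ->]]|/Pos_word_simple[l' [i e]]] := Pos_total ha.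
    by exists l', i.
  by exists l', i; rewrite -e reflN.
exists (l0 ++ i :: rev l0 ++ l); apply/lfunP => x.
rewrite comp_lfunE word_cat word_cons word_cat e.
rewrite -(@refl_isometry _ _ dot (word l0)) ?word_Krev //; exact: dot_word.
Qed.

Lemma word_group l : reflection_group dot Phi (word l).
Proof. by apply/group_word; exists l. Qed.

Lemma exists_exchange l : ~ (word l =1 id) -> exists i l',
  [/\ Pos (- word l (al i)), size l = (size l').+1 &
      word l' =1 word (rcons l i)].
Proof.
move=> nid; have [i hi] : exists i, ~ Pos (word l (al i)).
  apply: contrapT => h; apply: nid; apply: word_Pos_id => i.
  by apply: contrapT => hi; apply: h; exists i.
have [//|hn] := Pos_total (word_root l (simple_root i)).
by have [l' sl el] := word_exchange hn; exists i, l'.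
Qed.

(** * Vertices and their representatives without inversions in [Z] *)

Section Calibration.
Variable gamma : V.
Hypothesis gamma_ge0 : forall a, Pos a -> 0 <= dot gamma a.
Local Notation F := (Fset dot Phi Pos gamma).
Local Notation Z := (Zset dot Pos gamma).
Local Notation P := (Pset dot Phi gamma).

(** Dominance thus puts all of [P] inside [Pos], although [P] is cut out of [Phi]. *)
Lemma pairing_gt0_Pos a : Phi a -> 0 < dot gamma a -> Pos a.
Proof.
move=> /Pos_total[//|/gamma_ge0]; rewrite dotNr oppr_ge0 => /le_lt_trans h.
by move/h; rewrite ltxx.
Qed.

Lemma no_inversion_Z w : reflection_group dot Phi w ->
  inversions Pos w `&` Z = set0 <-> (forall a, Z a -> Pos (w a)).
Proof.
move=> /group_word[l ->]; split=> [e a ha|h]; last first.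
  by rewrite -subset0 => a [[_ ha] /h /Pos_asym]; apply.
have [//|hn] := Pos_total (word_root l (Pos_root ha.1)).
suff : set0 a by [].
by rewrite -e; split=> //; split=> //; case: ha.
Qed.

(** The pairing equals that of [gamma] with the preimage of [b]. If it is nonzero, dominance decides
    the sign of the preimage; if it is zero, the preimage is in [Z] up to sign, and [word l]
    preserves that sign. *)
Lemma Pos_preimage l b : inversions Pos (word l) `&` Z = set0 ->
  Phi b -> Pos (word (rev l) b) <->
    0 < dot (word l gamma) b \/ (dot (word l gamma) b = 0 /\ Pos b).
Proof.
move=> /(no_inversion_Z (word_group l)) hz hb.
have e : dot (word l gamma) b = dot gamma (word (rev l) b).
  by rewrite dotC -dot_word_rev dotC.
have hb' := word_root (rev l) hb.
rewrite e; split=> [hp|[|[e0 hp]]]; last first.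
- have [//|hn] := Pos_total hb'.
  have /hz : Z (- word (rev l) b) by split; rewrite // dotNr e0 oppr0.
  by rewrite linearN /= word_Krev => /(Pos_asym hp).
- exact: pairing_gt0_Pos.
have := gamma_ge0 hp; rewrite le_eqVlt => /orP[/eqP e0|]; last by left.
right; split=> //; rewrite -[b](word_Krev l); apply: hz.
by split.
Qed.

Lemma no_inversion_Z_inj w1 w2 :
  reflection_group dot Phi w1 -> inversions Pos w1 `&` Z = set0 ->
  reflection_group dot Phi w2 -> inversions Pos w2 `&` Z = set0 ->
  w1 gamma = w2 gamma -> w1 = w2.
Proof.
move=> /group_word[l1 ->] z1 /group_word[l2 ->] z2 e.
(* The criterion of [Pos_preimage] sees the group element only through the vertex, so it carries
   over from [w2] to [w1]. *)
have id12 : word (rev l1 ++ l2) =1 id.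
  apply: word_Pos_id => i; rewrite word_cat.
  have h := word_root l2 (simple_root i).
  apply/Pos_preimage => //; rewrite e; apply/(Pos_preimage z2) => //.
  by rewrite word_revK.
apply/lfunP => x; rewrite -[RHS](word_Krev l1) -(word_cat (rev l1)).
by rewrite id12.
Qed.

(** If a simple root orthogonal to [gamma] became negative, exchange would give a shorter word
    reaching the same vertex, as [s i] fixes [gamma]. *)
Lemma word_min_no_inversion_Z l :
  (forall l', word l' gamma = word l gamma -> (size l <= size l')%N) ->
  inversions Pos (word l) `&` Z = set0.
Proof.
move=> lmin; apply(no_inversion_Z (word_group l)).
move=> a [ha za].
apply: nonneg_coord_Pos => [|j]; first exact: (word_root _ (Pos_root ha)).
rewrite [a]coord_simple_sum !linear_sum /= sumr_ge0 // => i _.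
rewrite !linearZ /=.
have := Pos_coord_ge0 i ha; rewrite le_eqVlt => /orP[/eqP<-|ci].
  by rewrite mul0r.
apply: mulr_ge0; first exact: ltW.
(* The pairing of [gamma] with [a] is a sum of nonnegative terms equal to zero, and the coordinate
   at [i] is positive. *)
have zi : dot gamma (al i) = 0.
  have /eqP := za; rewrite [a]coord_simple_sum linear_sumr psumr_eq0.
    move=> /allP/(_ i (mem_index_enum _)) /=.
    by rewrite dotZr mulf_eq0 gt_eqF //= => /eqP.
  by move=> k _; rewrite /= dotZr mulr_ge0 ?Pos_coord_ge0 ?gamma_ge0.
have [|hn] := Pos_total (word_root l (simple_root i));
  first exact: Pos_coord_ge0.
have [l' sl el] := word_exchange hn.
have := lmin l'; rewrite sl ltnn => absurd; suff: false by []; apply: absurd.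
by rewrite el -cats1 word_cat word_cons word_nil refl_ortho.
Qed.

Lemma exists_no_inversion_Z w : reflection_group dot Phi w ->
  exists2 u, reflection_group dot Phi u /\ inversions Pos u `&` Z = set0 &
    u gamma = w gamma.
Proof.
move=> /group_word[l0 ->].
have [k] := ubnP (size l0); elim: k l0 => // k IH l; rewrite ltnS => sl.
have [lmin|] := pselect (forall l',
    word l' gamma = word l gamma -> (size l <= size l')%N).
  exists (word l) => //; split; first exact: word_group.
  exact: word_min_no_inversion_Z.
move=> /existsNP[l' /not_implyP[e /negP]]; rewrite -ltnNge => sl'.
have [|u hu eu] := IH l'; first exact: (leq_trans sl' sl).
by exists u; rewrite // eu.
Qed.

(** * Edges, paths and components *)

Lemma inversions_simple_refl (w : 'End(V)) i a : Phi a ->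
  w a != al i -> w a != - al i ->
  reflection_group dot Phi w ->
  inversions Pos (s i \o w)%VF a <-> inversions Pos w a.
Proof.
move=> ha n1 n2 /group_word[l e].
have hw : Phi (w a) by rewrite e; exact: word_root.
rewrite /inversions /= comp_lfunE; split=> -[pa h]; split=> //; last first.
  rewrite -linearN; apply: (simple_refl_Pos h _).
  by rewrite eqr_oppLR.
have [pw|//] := Pos_total hw.
by case: (Pos_asym (simple_refl_Pos pw n1)).
Qed.

(** Only roots that [w] sends to plus or minus [al i] can change inversion status; the three
    inequalities keep these out of [Z] and [P]. *)
Lemma Fset_step J w i : F J w -> dot (w gamma) (al i) != 0 ->
  dot (w gamma) (al i) != 1 -> dot (w gamma) (al i) != -1 ->
  F J (s i \o w)%VF.
Proof.
move=> [gw hz hp] n0 n1 nN1.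
have iso x y : dot (w x) (w y) = dot x y.
  by have /group_word[l ->] := gw; exact: dot_word.
have inv a : Z a \/ P a ->
      inversions Pos (s i \o w)%VF a <-> inversions Pos w a.
  move=> h; apply: inversions_simple_refl => //.
  - by case: h => [[/Pos_root]|[]].
  - apply/eqP => e; rewrite -e iso in n0 n1.
    by case: h => -[_ e1]; rewrite e1 eqxx in n0 n1.
  apply/eqP => e; rewrite -[al i]opprK -e dotNr iso oppr_eq0 ?eqr_opp in n0 nN1.
  by case: h => -[_ e1]; rewrite e1 eqxx in n0 nN1.
split; first by apply: reflection_groupM => //; exact: simple_root.
- rewrite -hz; apply/seteqP; split=> a [h za];
    split=> //; apply/inv => //; by left.
- rewrite -hp; apply/seteqP; split=> a [h za];
    split=> //; apply/inv => //; by right.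
Qed.

Lemma Fset_edge J u x y : F J u -> u gamma = x ->
  calibration_edge dot Phi alpha gamma x y -> exists2 u', F J u' & u' gamma = y.
Proof.
move=> hu ux [w [i [_ n1 nN1 e]]].
(* Applying [s i] negates the pairing with [al i], so the edge condition is the same at both
   ends. *)
have [e1 [m1 mN1]] : y = s i x /\ dot x (al i) != 1 /\ dot x (al i) != -1.
  case: e => -[-> ->]; first by [].
  rewrite reflK // dot_refl_sym // refl_self // linearN.
  by rewrite eqr_opp eqr_oppLR.
(* A loop: [u] itself is kept, since [s i] composed with [u] would invert a root of [Z]. *)
rewrite e1 -ux; have [z|nz] := eqVneq (dot x (al i)) 0.
  by exists u; rewrite // refl_ortho // ux.
exists (s i \o u)%VF; rewrite ?comp_lfunE //.
by apply: Fset_step; rewrite // ux.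
Qed.

Lemma Fset_connected J w1 w2 : F J w1 -> F J w2 ->
  calibration_connected dot Phi alpha gamma (w1 gamma) (w2 gamma).
Proof.
move=> f1 f2; have [_ z2 p2] := f2.
have [g2 _ _] := f2; have /(no_inversion_Z g2) h2 := z2.
have [l el] : exists l, w2 =1 word l \o w1.
  have [/group_word[l1 e1] _ _] := f1; have [/group_word[l2 e2] _ _] := f2.
  by exists (l2 ++ rev l1) => x; rewrite /= word_cat e1 word_revK e2.
have [k] := ubnP (size l); elim: k l w1 f1 el => // k IH l w1 f1 el.
rewrite ltnS => sl.
have [idl|/exists_exchange[i [l' [hn sl' el']]]] := pselect (word l =1 id).
  by rewrite el /= idl; exact: rt_refl.
have [g1 z1 p1] := f1; have /(no_inversion_Z g1) h1 := z1.
have iso x y : dot (w1 x) (w1 y) = dot x y.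
  by have /group_word[? ->] := g1; exact: dot_word.
have [a ra ea] : exists2 a, Phi a & w1 a = al i.
  have /group_word[l1 ->] := g1.
  by exists (word (rev l1) (al i)); [exact: word_root|exact: word_Krev].
have w2a : Pos (- w2 a) by rewrite el /= ea.
have nZ : ~ Z a by move/h2 => /Pos_asym; apply.
have nZN : ~ Z (- a).
  by move=> /h1; rewrite linearN /= ea => /(Pos_asym (simple_Pos i)).
(* [w2] inverts [a] while [w1] does not; for [- a] the roles are exchanged. Either root in [P] would
   contradict the common [J]. *)
have nP : ~ P a.
  move=> pa; have pos_a : Pos a.
    by apply: pairing_gt0_Pos ra _; case: pa => _ ->; exact: ltr01.
  have : J a by rewrite -p2; split.
  by rewrite -p1 => -[[_]]; rewrite ea => /(Pos_asym (simple_Pos i)).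
have nPN : ~ P (- a).
  move=> pa; have pos_a : Pos (- a).
    by apply: pairing_gt0_Pos pa.1 _; case: pa => _ ->; exact: ltr01.
  have : J (- a).
    by rewrite -p1; split=> //; split=> //; rewrite linearN /= opprK ea.
  by rewrite -p2 => -[[_]]; rewrite linearN /= opprK => /Pos_asym h _; exact: h.
have pairing : dot (w1 gamma) (al i) = dot gamma a by rewrite -ea iso.
have n0 : dot (w1 gamma) (al i) != 0.
  rewrite pairing; apply/eqP => e; have [pa|pa] := Pos_total ra.
    by apply: nZ.
  by apply: nZN; split; rewrite // dotNr e oppr0.
have n1 : dot (w1 gamma) (al i) != 1.
  by rewrite pairing; apply/eqP => e; apply: nP.
have nN1 : dot (w1 gamma) (al i) != -1.
  rewrite pairing; apply/eqP => e; apply: nPN; split; first exact: opp_root.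
  by rewrite dotNr e opprK.
have f1' := Fset_step f1 n0 n1 nN1.
apply: (@rt_trans _ _ _ ((s i \o w1)%VF gamma)).
  by apply: rt_step; exists w1, i; split=> //; left; rewrite comp_lfunE.
(* The factor [s i] at the end of the word cancels the one just put in front of [w1], so [l'] still
   leads to [w2]. *)
apply: (IH l' _ f1'); last by rewrite sl' in sl.
move=> x; rewrite el /= el' comp_lfunE -cats1 word_cat word_cons word_nil.
by rewrite reflK.
Qed.

Lemma translates_Fset_component J w : F J w ->
  translates (F J) gamma = [set y | calibration_vertices dot Phi gamma y /\
    calibration_connected dot Phi alpha gamma (w gamma) y].
Proof.
move=> fw; apply/seteqP; split=> [_ [u fu <-]|y [_ c]].
  by split; [exists u => //; case: fu|exact: (Fset_connected fw fu)].
have : exists2 u, F J u & u gamma = w gamma by exists w.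
(* The starting point is generalized so that lying in the image of [F J] becomes an invariant
   transported along paths. *)
suff h x : calibration_connected dot Phi alpha gamma x y ->
    (exists2 u, F J u & u gamma = x) -> exists2 u, F J u & u gamma = y.
  exact: h.
elim=> {w y fw c x} [x y e [u fu ux]|//|x y z _ h1 _ h2 /h1/h2//].
exact: Fset_edge fu ux e.
Qed.

(** Allowing two sets [J1] and [J2] gives both injectivity on one [F J] and disjointness of the
    images for different [J]. *)
Lemma Fset_translate_inj J1 J2 w1 w2 : F J1 w1 -> F J2 w2 ->
  w1 gamma = w2 gamma -> w1 = w2.
Proof. by move=> [g1 z1 _] [g2 z2 _]; exact: no_inversion_Z_inj. Qed.

Lemma translates_Fset_inj J1 J2 : F J1 !=set0 ->
  translates (F J1) gamma = translates (F J2) gamma -> J1 = J2.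
Proof.
move=> [w1 f1] e; have : translates (F J1) gamma (w1 gamma) by exists w1.
rewrite e => -[w2 f2 /esym e12].
have w12 := Fset_translate_inj f1 f2 e12.
by case: f1 f2 => _ _ <-; rewrite w12 => -[_ _ <-].
Qed.

Lemma component_Fset A : is_calibration_component dot Phi alpha gamma A ->
  exists J, [/\ J `<=` P, F J !=set0 & translates (F J) gamma = A].
Proof.
move=> [_ [w gw <-] ->]; have [u [gu zu] <-] := exists_no_inversion_Z gw.
exists (inversions Pos u `&` P).
have fu : F (inversions Pos u `&` P) u by split.
split; [exact: subIsetr|by exists u|exact: translates_Fset_component].
Qed.

End Calibration.

(** The chamber lies in a closed half-space, hence so does its closure. *)
Lemma dominant_ge0 gamma a : dominant dot Pos gamma -> Pos a ->
  0 <= dot gamma a.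
Proof.
move=> hg ha.
have closed_halfspace : closed [set x : V | 0 <= dot x a].
  apply: (@closed_comp _ _ (fun x : V => dot x a) [set r | 0 <= r]).
    by move=> x _; exact: dot_continuous.
  exact: closed_ge.
apply: closed_halfspace; move: hg; apply: closure_subset => x /(_ a ha).
exact: ltW.
Qed.

End CoxeterGroup.

Theorem theorem2p1 (R : realType) (n : nat) (dot : {dot 'cV[R]_n for idfun})
    (Phi Pos : set 'cV[R]_n) (alpha : n.-tuple 'cV[R]_n) (gamma : 'cV[R]_n)
    (hPhi : is_root_system dot Phi)
    (hPos : is_positive_system dot Phi Pos)
    (halpha : is_simple_system Phi Pos alpha)
    (hgamma : dominant dot Pos gamma) :
  (forall J : set 'cV[R]_n,
     J `<=` Pset dot Phi gamma -> Fset dot Phi Pos gamma J !=set0 ->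
     set_inj (Fset dot Phi Pos gamma J) (fun w : 'End('cV[R]_n) => w gamma) /\
     is_calibration_component dot Phi alpha gamma
       (translates (Fset dot Phi Pos gamma J) gamma)) /\
  set_bij
    [set J : set 'cV[R]_n |
       J `<=` Pset dot Phi gamma /\ Fset dot Phi Pos gamma J !=set0]
    [set A : set 'cV[R]_n | is_calibration_component dot Phi alpha gamma A]
    (fun J : set 'cV[R]_n => translates (Fset dot Phi Pos gamma J) gamma).
Proof.
have gamma_ge0 a : Pos a -> 0 <= dot gamma a by exact: dominant_ge0 hgamma.
have component J : Fset dot Phi Pos gamma J !=set0 ->
    is_calibration_component dot Phi alpha gamma
      (translates (Fset dot Phi Pos gamma J) gamma).
  move=> [w fw]; exists (w gamma); first by exists w => //; case: fw.
  exact: (translates_Fset_component hPhi hPos halpha gamma_ge0 fw).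
split=> [J _ nJ|].
  split; last exact: component.
  by move=> w1 w2 /set_mem f1 /set_mem f2;
    exact: (Fset_translate_inj hPhi hPos halpha gamma_ge0 f1 f2).
split=> [J [_ nJ]|J1 J2 /set_mem[_ n1] _|A /=]; first exact: component.
- exact: (translates_Fset_inj hPhi hPos halpha gamma_ge0 n1).
- by move=> /(component_Fset hPhi hPos halpha gamma_ge0)[J [sJ nJ e]]; exists J.
Qed.
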